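(* Let $L$ be a locale and $F$ a closed nowhere dense sublocale of $L$. If $F$ is homogeneous maximal nowhere dense and $A$ is a non-void $F$-regular-closed sublocale, then $A$ is homogeneous maximal nowhere dense (in $L$).
   Context: $\mathsf{O}=\{1\}$ is the void sublocale. A sublocale $N$ of $L$ is nowhere dense if $N\cap\mathfrak{B}L=\mathsf{O}$, where $\mathfrak{B}L=\{x\to 0:x\in L\}$. For a sublocale $S$ of $L$, ''$N$ is nowhere dense in $S$'' means $N\subseteq S$ and $N$ is a nowhere dense sublocale of the locale $S$. A nowhere dense sublocale $N$ of $L$ is maximal nowhere dense if there is no nowhere dense sublocale $S$ of $L$ such that $N$ is nowhere dense in $S$. A regular-closed sublocale of a locale is the closure of some open sublocale; ''$F$-regular-closed'' means regular-closed in the locale $F$. A closed nowhere dense sublocale $N$ of $L$ is homogeneous maximal nowhere dense if each non-void $N$-regular-closed sublocale is maximal nowhere dense in $L$. *)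

(* Defs.v *)
From HB Require Import structures.
From mathcomp Require Import all_boot all_order.
From mathcomp Require Import boolp classical_sets.

Set Implicit Arguments.
Unset Strict Implicit.
Unset Printing Implicit Defensive.

Import Order.TTheory.

Local Open Scope classical_set_scope.
Local Open Scope order_scope.

(* A locale is handled through its frame of opens. *)
HB.mixin Record TBLattice_isFrame d T of Order.TBLattice d T := {
  bigjoin : set T -> T;
  bigjoin_sup : forall A : set T, supremums A (bigjoin A);
  meet_bigjoinr : forall (x : T) (A : set T),
    x `&` bigjoin A = bigjoin [set x `&` a | a in A]
}.

#[short(type="frameType")]
HB.structure Definition Frame d :=
  { T of Order.TBLattice d T & TBLattice_isFrame d T }.

Section FrameOps.
Context {d : Order.disp_t} {L : frameType d}.
Implicit Types (A : set L) (x y z : L).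

Definition bigmeet A : L := bigjoin (lbound A).

Definition himp x y : L := bigjoin [set z | z `&` x <= y].

Lemma bigjoin_ub A x : A x -> x <= bigjoin A.
Proof. by have [+ _] := bigjoin_sup A; apply. Qed.

Lemma bigjoin_le A y : (forall x, A x -> x <= y) -> bigjoin A <= y.
Proof. by have [_ +] := bigjoin_sup A; apply. Qed.

Lemma bigmeet_lb A x : A x -> bigmeet A <= x.
Proof. by move=> Ax; apply: bigjoin_le => y; apply. Qed.

Lemma bigmeet_ge A y : (forall x, A x -> y <= x) -> y <= bigmeet A.
Proof. by move=> h; apply: bigjoin_ub => x /h. Qed.

Lemma himpP x y z : (z <= himp x y) = (z `&` x <= y).
Proof.
apply/idP/idP => [le_z|]; last by move=> h; apply: bigjoin_ub.
apply: (le_trans (leI2 le_z (lexx x))).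
rewrite meetC meet_bigjoinr; apply: bigjoin_le => _ [w /= le_w <-].
by rewrite meetC.
Qed.

Lemma himp_bigmeet x A : himp x (bigmeet A) = bigmeet [set himp x a | a in A].
Proof.
apply/le_anti/andP; split.
  apply: bigmeet_ge => _ [a Aa <-]; rewrite himpP.
  by apply: le_trans (bigmeet_lb Aa); rewrite -himpP.
rewrite himpP; apply: bigmeet_ge => a Aa; rewrite -himpP.
by apply: bigmeet_lb; exists a.
Qed.

Lemma himp_curry x y z : himp x (himp y z) = himp (x `&` y) z.
Proof.
have E w : (w <= himp x (himp y z)) = (w <= himp (x `&` y) z).
  by rewrite !himpP meetA.
by apply/le_anti/andP; split; rewrite ?E // -E.
Qed.

End FrameOps.

Record sublocale d (L : frameType d) := Sublocale {
  sublocale_set :> set L;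
  sublocale_bigmeet : forall A : set L,
    A `<=` sublocale_set -> sublocale_set (bigmeet A);
  sublocale_himp : forall x s : L,
    sublocale_set s -> sublocale_set (himp x s)
}.

(* A sublocale, seen as a locale in its own right: meets are those of L, joins
   are the least upper bounds inside S. *)
Definition frame_of d (L : frameType d) (S : sublocale L) : Type :=
  {x : L | x \in (S : set L)}.

Section FrameOf.
Context (d : Order.disp_t) (L : frameType d) (S : sublocale L).
Local Notation U := (frame_of S).

HB.instance Definition _ := SubChoice.on U.
HB.instance Definition _ := [SubChoice_isSubPOrder of U by <: with d].

Implicit Types (A : set U) (u v w : U).

Lemma frame_ofP u : (S : set L) (val u).
Proof. exact/set_mem/(valP u). Qed.

Definition to_frame_of x (Sx : (S : set L) x) : U := exist _ x (mem_set Sx).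

Lemma leU u v : (u <= v) = (val u <= val v).
Proof. by []. Qed.

Lemma sub_meet_subproof u v : (S : set L) (val u `&` val v).
Proof.
have -> : val u `&` val v = bigmeet [set val u; val v].
  apply/le_anti/andP; split.
    by apply: bigmeet_ge => _ [->|->]; rewrite ?leIl ?leIr.
  by rewrite lexI !bigmeet_lb //; [right|left].
by apply: sublocale_bigmeet => _ [->|->]; exact: frame_ofP.
Qed.

Lemma sub_bigmeet_subproof A : (S : set L) (bigmeet (val @` A)).
Proof. by apply: sublocale_bigmeet => _ [u _ <-]; exact: frame_ofP. Qed.

Definition smeet u v : U := to_frame_of (sub_meet_subproof u v).
Definition sbigmeet A : U := to_frame_of (sub_bigmeet_subproof A).
Definition sbigjoin A : U := sbigmeet (ubound A).

Lemma sbigmeet_lb A u : A u -> sbigmeet A <= u.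
Proof. by move=> Au; rewrite leU; apply: bigmeet_lb; exists u. Qed.

Lemma sbigmeet_ge A v : (forall u, A u -> v <= u) -> v <= sbigmeet A.
Proof. by move=> h; rewrite leU; apply: bigmeet_ge => _ [u /h + <-]. Qed.

Lemma slexI u v w : (u <= smeet v w) = (u <= v) && (u <= w).
Proof. by rewrite !leU lexI. Qed.

HB.instance Definition _ := Order.POrder_isMeetSemilattice.Build d U slexI.

Lemma sleUx u v w : (sbigjoin [set u; v] <= w) = (u <= w) && (v <= w).
Proof.
apply/idP/andP => [le_w|[uw vw]]; last first.
  by apply: sbigmeet_lb => _ [->|->].
by split; apply: le_trans le_w; apply: sbigmeet_ge => t; apply; [left|right].
Qed.

HB.instance Definition _ := Order.POrder_isJoinSemilattice.Build d U sleUx.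

Lemma sle0x u : sbigmeet setT <= u. Proof. exact: sbigmeet_lb. Qed.
Lemma slex1 u : u <= sbigmeet set0. Proof. exact: sbigmeet_ge. Qed.

HB.instance Definition _ := Order.hasBottom.Build d U sle0x.
HB.instance Definition _ := Order.hasTop.Build d U slex1.

Lemma sbigjoin_sup A : supremums A (sbigjoin A).
Proof.
split=> [u Au|u]; last exact: sbigmeet_lb.
by apply: sbigmeet_ge => v; apply.
Qed.

Lemma sbigjoin_ub A u : A u -> u <= sbigjoin A.
Proof. by have [+ _] := sbigjoin_sup A; apply. Qed.

Lemma smeet_bigjoinr u A : u `&` sbigjoin A = sbigjoin [set u `&` a | a in A].
Proof.
apply/le_anti/andP; split; last first.
  apply: sbigmeet_lb => _ [a Aa <-]; apply: leI2 => //.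
  exact: sbigjoin_ub.
set b := sbigjoin [set _ | _ in _].
pose i := to_frame_of (sublocale_himp (val u) (frame_ofP b)).
have : sbigjoin A <= i.
  apply: sbigmeet_lb => a Aa; rewrite leU himpP meetC.
  have /sbigjoin_ub : [set u `&` a | a in A] (u `&` a) by exists a.
  by rewrite leU.
by rewrite leU himpP meetC.
Qed.

HB.instance Definition _ :=
  TBLattice_isFrame.Build d U sbigjoin_sup smeet_bigjoinr.

Lemma val_meet u v : val (u `&` v) = val u `&` val v.
Proof. by []. Qed.

Lemma val_bigmeet A : val (bigmeet A) = bigmeet (val @` A).
Proof.
suff -> : bigmeet A = sbigmeet A by [].
apply/le_anti/andP; split; first by apply: sbigmeet_ge => u /bigmeet_lb.
by apply: bigmeet_ge => u /sbigmeet_lb.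
Qed.

Lemma val_himp u v : val (himp u v) = himp (val u) (val v).
Proof.
suff -> : himp u v = to_frame_of (sublocale_himp (val u) (frame_ofP v)) by [].
apply/le_anti/andP; split; last by rewrite himpP leU -himpP.
by rewrite leU himpP -val_meet -leU -himpP.
Qed.

End FrameOf.

Section Sublocales.
Context {d : Order.disp_t} {L : frameType d}.
Implicit Types (a x : L) (A F N S : sublocale L).

Lemma trace_bigmeet S N (A : set (frame_of S)) :
  A `<=` [set u | (N : set L) (val u)] -> (N : set L) (val (bigmeet A)).
Proof.
by move=> AN; rewrite val_bigmeet; apply: sublocale_bigmeet => _ [u /AN + <-].
Qed.

Lemma trace_himp S N (u v : frame_of S) :
  (N : set L) (val v) -> (N : set L) (val (himp u v)).
Proof. by rewrite val_himp; exact: sublocale_himp. Qed.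

(* S `&` N, as a sublocale of the locale S; when N `<=` S this is N itself. *)
Definition trace S N : sublocale (frame_of S) :=
  Sublocale (@trace_bigmeet S N) (@trace_himp S N).

Lemma closed_bigmeet a (B : set L) :
  B `<=` [set x | a <= x] -> a <= bigmeet B.
Proof. exact: bigmeet_ge. Qed.

Lemma closed_himp a x s : a <= s -> a <= himp x s.
Proof. by move=> le_as; rewrite himpP; apply: le_trans (leIl _ _) le_as. Qed.

Definition closed_sublocale a : sublocale L :=
  @Sublocale d L [set x | a <= x] (@closed_bigmeet a) (@closed_himp a).

Lemma open_bigmeet a (B : set L) :
  B `<=` range (himp a) -> range (himp a) (bigmeet B).
Proof.
move=> BO; exists (bigmeet B) => //; apply/le_anti/andP; split; last first.
  by rewrite himpP leIl.
rewrite himp_bigmeet; apply: bigmeet_ge => x Bx.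
apply: le_trans (bigmeet_lb _) _; first by exists x.
by have [y _ <-] := BO x Bx; rewrite himp_curry meetxx.
Qed.

Lemma open_himp a x s : range (himp a) s -> range (himp a) (himp x s).
Proof.
by move=> [y _ <-]; exists (himp x y); rewrite // !himp_curry meetC.
Qed.

Definition open_sublocale a : sublocale L :=
  Sublocale (@open_bigmeet a) (@open_himp a).

Definition is_closed S : Prop :=
  exists a, (S : set L) = closed_sublocale a.

Definition closure_set S : set L :=
  \bigcap_(C in [set C : sublocale L | is_closed C /\ S `<=` C]) C.

Lemma closure_bigmeet S (B : set L) :
  B `<=` closure_set S -> closure_set S (bigmeet B).
Proof.
by move=> BS C hC; apply: sublocale_bigmeet => x /BS; apply.
Qed.

Lemma closure_himp S x s : closure_set S s -> closure_set S (himp x s).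
Proof. by move=> Ss C hC; apply: sublocale_himp; exact: Ss. Qed.

(* The least closed sublocale containing S, see closureE. *)
Definition closure S : sublocale L :=
  Sublocale (@closure_bigmeet S) (@closure_himp S).

Lemma closureE S : (closure S : set L) = closed_sublocale (bigmeet S).
Proof.
apply/seteqP; split=> [x|x /= le_x C [[a Ca] SC]].
  apply; split; first by exists (bigmeet S).
  by move=> y /bigmeet_lb.
rewrite Ca /=; apply: le_trans le_x; apply: bigmeet_ge => y /SC.
by rewrite Ca.
Qed.

Definition regular_closed A : Prop :=
  exists a, (A : set L) = closure (open_sublocale a).

Definition void_sublocale : set L := [set \top].

Definition booleanization : set L := range (himp^~ \bot).

Definition nowhere_dense N : Prop :=
  (N : set L) `&` booleanization = void_sublocale.

End Sublocales.

Section MaximalNowhereDense.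
Context {d : Order.disp_t} {L : frameType d}.
Implicit Types A F N S : sublocale L.

Definition nowhere_dense_in S N : Prop :=
  N `<=` S /\ nowhere_dense (trace S N).

Definition regular_closed_in F A : Prop :=
  A `<=` F /\ regular_closed (trace F A).

Definition maximal_nowhere_dense N : Prop :=
  nowhere_dense N /\
  ~ (exists S, nowhere_dense S /\ nowhere_dense_in S N).

Definition homogeneous_maximal_nowhere_dense N : Prop :=
  [/\ is_closed N, nowhere_dense N &
      forall A, regular_closed_in N A -> (A : set L) <> void_sublocale ->
        maximal_nowhere_dense A].

End MaximalNowhereDense.

(* Main.v *)
(* For closed F = {x | f <= x}, the F-regular-closed sublocales are the sets
   {x | (a -> f) <= x} with f <= a. Since b -> (a -> f) = (b /\ a) -> f, a
   regular-closed sublocale of an F-regular-closed sublocale is again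
   F-regular-closed, so homogeneity passes from F to A. *)
Require Import Defs.
From mathcomp Require Import all_boot all_order.
From mathcomp Require Import boolp classical_sets.

Set Implicit Arguments.
Unset Strict Implicit.
Unset Printing Implicit Defensive.

Import Order.TTheory.

Local Open Scope classical_set_scope.
Local Open Scope order_scope.

(** The least element of the open sublocale is its member [himp a \bot], since [himp a] is monotone;
    a closure is the up-set of the meet. *)
Lemma closure_openE (d : Order.disp_t) (L : frameType d) (a : L) :
  (Defs.closure (open_sublocale a) : set L) = closed_sublocale (himp a \bot).
Proof.
rewrite closureE.
suff -> : bigmeet (open_sublocale a) = himp a \bot by [].
apply/le_anti/andP; split; first by apply: bigmeet_lb; exists \bot.
apply: bigmeet_ge => _ [y _ <-].
by rewrite himpP; apply: le_trans (le0x y); rewrite -himpP.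
Qed.

Section RegularClosedIn.
Context {d : Order.disp_t} {L : frameType d}.
Implicit Types (f : L) (A F : sublocale L).

Lemma val_bot_closed f F :
  (F : set L) = closed_sublocale f -> val (\bot : frame_of F) = f.
Proof.
move=> FE; have FP x : (F : set L) x <-> f <= x by rewrite FE.
have Ff : (F : set L) f by apply/FP.
apply/le_anti/andP; split; first exact: (le0x (to_frame_of Ff)).
exact/FP/frame_ofP.
Qed.

(** Implication in [F] agrees with that of [L] and the bottom of [F] is [f], so the pseudocomplement
    of [a] in [F] is [himp a f]. *)
Lemma regular_closed_inP f F A : (F : set L) = closed_sublocale f ->
  regular_closed_in F A <->
  exists2 a, f <= a & (A : set L) = closed_sublocale (himp a f).
Proof.
move=> FE; have FP x : (F : set L) x <-> f <= x by rewrite FE.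
have vE (a u : frame_of F) :
    (Defs.closure (open_sublocale a) : set _) u = (himp (val a) f <= val u) :> Prop.
  by rewrite closure_openE /= leU val_himp (val_bot_closed FE).
split=> [[AF [a Aa]]|[a fa AE]].
  exists (val a); first exact/FP/frame_ofP.
  have trE (u : frame_of F) : (A : set L) (val u) <-> himp (val a) f <= val u.
    by rewrite -vE -Aa.
  apply/seteqP; split=> x; first by move=> Ax; apply/(trE (to_frame_of (AF x Ax))).
  (* As [f <= himp a f], the up-set of [himp a f] already lies in [F]. *)
  move=> /= le_x; have Fx : (F : set L) x.
    by apply/FP/(le_trans _ le_x); rewrite himpP leIl.
  exact/(trE (to_frame_of Fx)).
split=> [x|].
  by rewrite AE /= => le_x; apply/FP/(le_trans _ le_x); rewrite himpP leIl.
exists (to_frame_of ((FP a).2 fa)).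
by apply/funext => u; rewrite vE /= AE.
Qed.

Lemma regular_closed_in_trans F A B : is_closed F ->
  regular_closed_in F A -> regular_closed_in A B -> regular_closed_in F B.
Proof.
move=> [f FE] /(regular_closed_inP _ FE)[a fa AE].
move=> /(regular_closed_inP _ AE)[b gb BE]; apply/(regular_closed_inP _ FE).
exists (b `&` a); last by rewrite BE himp_curry.
(* Here [f <= himp a f <= b]. *)
by rewrite lexI fa andbT; apply: le_trans gb; rewrite himpP leIl.
Qed.

End RegularClosedIn.

Theorem proposition3p7 (d : Order.disp_t) (L : frameType d) (F A : sublocale L)
    (F_closed : is_closed F) (F_nd : nowhere_dense F)
    (F_hmnd : homogeneous_maximal_nowhere_dense F)
    (A_nonvoid : (A : set L) <> void_sublocale)
    (A_rc : regular_closed_in F A) :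
  homogeneous_maximal_nowhere_dense A.
Proof.
have [_ _ F_max] := F_hmnd; split.
- have [f FE] := F_closed.
  by have [a _ AE] := (regular_closed_inP _ FE).1 A_rc; exists (himp a f).
(* Homogeneity of [F] applied to [A] itself makes [A] maximal nowhere dense, hence nowhere dense. *)
- by have [] := F_max A A_rc A_nonvoid.
- move=> B B_rc; apply: F_max; exact: regular_closed_in_trans B_rc.
Qed.
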